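(* Let $\mathcal{C}_{\mathbb{P}^2}=\{p_i\}_{i=1}^N$, $N\ge2$, be a configuration over the projective plane $\mathbb{P}^2$, let $\pi_1:\mathbb{F}_1\to\mathbb{P}^2$ be the blowup at $p_1$, let $\mathcal{C}_1:=\{p_i\}_{i=2}^N$, regarded as a configuration over $\mathbb{F}_1$, and let $\pi':Z_{\mathcal{C}_{\mathbb{P}^2}}=Z_{\mathcal{C}_1}\to\mathbb{F}_1$ be the corresponding composition of blowups. Let $L$ be a general line in $\mathbb{P}^2$ and set $\mathbf{a}:=\mathbf{a}(\mathrm{APG}(Z_{\mathcal{C}_{1}},\pi'))$. Then $$\frac{\tilde{C}^2}{((\iota L^*-\tau E_{p_1}^* )\cdot \tilde{C})^2}\geq -(\mathbf{a}-1)$$ for any non-zero divisor $\iota L^*-\tau E_{p_1}^*$ on $Z_{\mathcal{C}_{\mathbb{P}^2}}$ such that $\iota,\tau \in \mathbb{Z}_{\geq 0}$ and $\iota \geq \tau$, and for any integral curve $C$ on $\mathbb{P}^2$ which is not a line passing through $p_1$.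
   Context: Everything is over an algebraically closed field $k$ of arbitrary characteristic; integral means reduced and irreducible. Configurations: a configuration over a smooth projective surface $X_0$ is a non-empty set $\{p_i\}_{i=1}^N$ with $p_i$ a closed point of $X_{i-1}$, where $X_i\to X_{i-1}$ is the blowup at $p_i$. For $X_0=\mathbb{P}^2$ the surface $X_N$ is denoted $Z_{\mathcal{C}_{\mathbb{P}^2}}$. $E_{p_i}$ is the exceptional divisor created by blowing up $p_i$; $D^*$ and $\tilde D$ denote total and strict transforms on $Z_{\mathcal{C}_{\mathbb{P}^2}}$. The point $p_j$ is proximate to $p_i$ ($p_j\to p_i$) if $j>i$ and $p_j$ lies on the strict transform of $E_{p_i}$ on $X_{j-1}$. A smooth curve on one of the surfaces $X_l$ goes through $p_i$ ($i>l$) in the infinitely near sense if its strict transform on $X_{i-1}$ contains $p_i$. The blowup of $\mathbb{P}^2$ at $p_1$ is identified with the Hirzebruch surface $\mathbb{F}_1$; its fibers are the strict transforms of the lines through $p_1$ and its special section $M_0^1$ (self-intersection $-1$) is $E_{p_1}$. The value $\mathbf{a}$: let $K\subset\mathbb{R}^{N+1}$ be the cone of vectors $(x,y,m_{2},\dots,m_{N})$ such that $m_{i}\ge\sum_{p_j\to p_i}m_{j}$ for all $2\le i\le N$; $y\ge\sum_{p_i\in F}m_i$ for every fiber $F$ of $\mathbb{F}_1$ through some point of $\mathcal{C}_1\cap\mathbb{F}_1$ (the sum over the $p_i$, $i\ge2$, that $F$ goes through in the infinitely near sense); and $x\ge\sum_{p_i\in M_0^1}m_i$ (the sum over the $p_i$,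 $i\ge2$, that $M_0^1=E_{p_1}$ goes through in the infinitely near sense). Then $\mathbf{a}(\mathrm{APG}(Z_{\mathcal{C}_1},\pi'))$ is the smallest positive integer $t$ such that $2xy+ty^2-\sum_{i\ge2} m_i^2\ge0$ for all vectors in $K$. It depends only on the arrowed proximity graph APG of $(Z_{\mathcal{C}_1},\pi')$, i.e. on the proximity relations in $\mathcal{C}_1$ and on which points the fibers and the special section go through. *)

(* Defs.v *)
From HB Require Import structures.
From mathcomp Require Import all_boot all_order all_algebra.
From mathcomp Require Import boolp classical_sets reals.
From mathcomp Require Import mpoly.

Set Implicit Arguments.
Unset Strict Implicit.
Unset Printing Implicit Defensive.

Import Order.TTheory GRing.Theory Num.Theory.

Local Open Scope ring_scope.

(* Closed points of the projective plane, given by their normalised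
   homogeneous coordinates: (a : b : 1), (a : 1 : 0) and (1 : 0 : 0). *)
Inductive plane_point (k : Type) : Type :=
| PAff of k & k
| PInf of k
| PTop.
Arguments PTop {k}.

(* An infinitely near point of the plane: a point q0 of the plane together
   with a finite sequence of tangent directions.  The point (q0, [:: d1; ..; dr])
   is the point with direction dr on the exceptional curve obtained by blowing
   up (q0, [:: d1; ..; d_(r-1)]).  The directions at a point with local
   coordinates (x, y) form a projective line: [Some c] is the direction of
   y = c x, [None] is the direction of x = 0. *)
Definition near_point (k : Type) : Type :=
  (plane_point k * seq (option k))%type.

Definition strictly_below (k : Type) (q r : near_point k) : Prop :=
  q.1 = r.1 /\ exists d e, r.2 = q.2 ++ d :: e.

(* [q] is a closed point of the surface obtained from the plane by blowing up
   the points of [B] ([B] being closed under [strictly_below]): every point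
   below [q] has been blown up, and [q] itself has not. *)
Definition closed_point_of_blowup (k : Type) (B : near_point k -> Prop)
    (q : near_point k) : Prop :=
  ~ B q /\ forall r, strictly_below r q -> B r.

(* Indices start at 0: the point p_i of the text is [p] at index i - 1. *)
Definition is_configuration (k : Type) (N : nat) (p : 'I_N -> near_point k)
  : Prop :=
  forall i : 'I_N, closed_point_of_blowup
              (fun q => exists2 j : 'I_N, (j < i)%N & q = p j) (p i).

Section LocalEquations.
Variable k : closedFieldType.

Local Notation x := ('X_(@ord0 1) : {mpoly k[2]}).
Local Notation y := ('X_(@ord_max 1) : {mpoly k[2]}).

(* Dehomogenisation of a form in affine coordinates (x, y) centred at [q]. *)
Definition local_form (q : plane_point k) (F : {mpoly k[3]}) : {mpoly k[2]} :=
  match q with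
  | PAff a b => F \mPo [tuple x + a%:MP; y + b%:MP; 1]
  | PInf a => F \mPo [tuple x + a%:MP; 1; y]
  | PTop => F \mPo [tuple 1; x; y]
  end.

(* Multiplicity at the origin (the default value [msize f] is never reached
   when f <> 0). *)
Definition mult0 (f : {mpoly k[2]}) : nat :=
  \big[minn/msize f]_(m <- msupp f) mdeg m.

(* The origin lies on the curve f = 0. *)
Definition vanishes0 (f : {mpoly k[2]}) : bool := f@_0%MM == 0.

(* The blowup of the origin, in local coordinates (x, y) centred at the point
   of the exceptional curve with direction [d]: the map is
   (x, y) |-> (x, x (y + c)) for d = Some c, and (x, y) |-> (x y, y) for
   d = None.  The exceptional curve is x = 0, respectively y = 0. *)
Definition blowup_chart (d : option k) : 2.-tuple {mpoly k[2]} :=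
  match d with
  | Some c => [tuple x; x * (y + c%:MP)]
  | None => [tuple x * y; y]
  end.

Definition exceptional_eq (d : option k) : {mpoly k[2]} :=
  if d is Some _ then x else y.

(* Equation of the strict transform in the chart [blowup_chart d]: the pullback
   of f divided by the equation of the exceptional curve to the power mult0 f
   (see [blowup_chart_strict_eq]), the division being done monomial by
   monomial. *)
Definition strict_eq (f : {mpoly k[2]}) (d : option k) : {mpoly k[2]} :=
  \sum_(m <- msupp f) f@_m *:
    match d with
    | Some c => x ^+ (mdeg m - mult0 f) * (y + c%:MP) ^+ (m ord_max)
    | None => x ^+ (m ord0) * y ^+ (mdeg m - mult0 f)
    end.

Lemma mult0_le (f : {mpoly k[2]}) m : m \in msupp f -> (mult0 f <= mdeg m)%N.
Proof.
rewrite /mult0; elim: (msupp f) => // a s IHs.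
rewrite inE big_cons => /orP[/eqP ->|/IHs]; first exact: geq_minl.
exact/leq_trans/geq_minr.
Qed.

Lemma blowup_chart_strict_eq (f : {mpoly k[2]}) (d : option k) :
  f \mPo blowup_chart d = exceptional_eq d ^+ mult0 f * strict_eq f d.
Proof.
rewrite comp_mpolyE /strict_eq mulr_sumr; apply: eq_big_seq => m m_f.
rewrite -scalerAr; congr (_ *: _).
rewrite big_ord_recl big_ord1 !(tnth_nth 0).
have -> : lift ord0 (@ord0 0) = ord_max by apply: val_inj.
have md : mdeg m = (m ord0 + m ord_max)%N.
  rewrite mdegE big_ord_recl big_ord1; congr (_ + m _)%N.
  exact: val_inj.
have le_m := mult0_le m_f.
case: d => [c|] /=; rewrite exprMn.
  by rewrite mulrA -exprD -md [RHS]mulrA -exprD subnKC.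
by rewrite -mulrA -exprD -md [RHS]mulrCA -exprD subnKC.
Qed.

(* Local equation at [q] of the strict transform, on any surface of which [q]
   is a closed point, of the plane curve F = 0. *)
Definition strict_eq_at (F : {mpoly k[3]}) (q : near_point k) : {mpoly k[2]} :=
  foldl strict_eq (local_form q.1 F) q.2.

Definition mult_at (F : {mpoly k[3]}) (q : near_point k) : nat :=
  mult0 (strict_eq_at F q).

(* The plane curve F = 0 goes through [q] in the infinitely near sense. *)
Definition goes_through (F : {mpoly k[3]}) (q : near_point k) : bool :=
  vanishes0 (strict_eq_at F q).

(* [q] lies on the strict transform of the exceptional curve created by blowing
   up [r]. *)
Definition on_exceptional (q r : near_point k) : Prop :=
  q.1 = r.1 /\ exists d e, q.2 = r.2 ++ d :: e /\
    vanishes0 (foldl strict_eq (exceptional_eq d) e).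

Definition proximate (N : nat) (p : 'I_N -> near_point k) (j i : 'I_N) : Prop :=
  (i < j)%N /\ on_exceptional (p j) (p i).

End LocalEquations.

(* Integral plane curves. *)
Record integral_curve (k : closedFieldType) := IntegralCurve {
  curve_deg : nat;
  curve_eq : {mpoly k[3]};
  curve_homog : curve_eq \is curve_deg.-homog;
  curve_neq0 : curve_eq != 0;
  curve_nonunit : curve_eq \isn't a GRing.unit;
  curve_irreducible : forall G H : {mpoly k[3]},
    curve_eq = G * H -> G \is a GRing.unit \/ H \is a GRing.unit
}.

Definition line_through (k : closedFieldType) (C : integral_curve k)
    (q : near_point k) : Prop :=
  curve_deg C = 1%N /\ goes_through (curve_eq C) q.

(* The data of an arrowed proximity graph: the proximity relation
   ([apg_prox j i] stands for j -> i), the vertex sets of the fibers going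
   through some point of the configuration lying on the Hirzebruch surface,
   and the vertex set of the special section. *)
Record apg := APG {
  apg_vertex : finType;
  apg_prox : rel apg_vertex;
  apg_fiber : {set apg_vertex} -> Prop;
  apg_section : {set apg_vertex}
}.

Section ValueA.
Variable R : realType.

Definition in_cone (G : apg) (x y : R) (m : apg_vertex G -> R) : Prop :=
  [/\ forall i, m i >= \sum_(j | apg_prox j i) m j,
      forall F, apg_fiber F -> y >= \sum_(i in F) m i
    & x >= \sum_(i in apg_section G) m i].

Definition a_admissible (G : apg) (t : nat) : Prop :=
  (0 < t)%N /\ forall (x y : R) (m : apg_vertex G -> R), in_cone x y m ->
    0 <= 2 * x * y + t%:R * y ^+ 2 - \sum_i m i ^+ 2.

(* The smallest admissible integer (0 when there is none, which does not happen
   for the graph of a non-empty configuration). *)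
Definition a_value (G : apg) : nat :=
  xget 0%N (fun t => a_admissible G t /\
                     forall s, a_admissible G s -> (t <= s)%N).

End ValueA.

Section OverPlane.
Variables (k : closedFieldType) (n : nat) (p : 'I_n.+2 -> near_point k).

(* [l] is the equation of a line through p_1; its strict transform is a fiber
   of the blowup of the plane at p_1. *)
Definition fiber_eq (l : {mpoly k[3]}) : Prop :=
  [/\ l \is 1.-homog, l != 0 & goes_through l (p ord0)].

Definition on_F1 (q : near_point k) : Prop :=
  closed_point_of_blowup (fun r => r = p ord0) q.

(* The configuration over the blowup of the plane at p_1: the vertex i is the
   point [p (lift ord0 i)]. *)
Definition apg_F1 : apg :=
  @APG 'I_n.+1
    (fun j i => `[< proximate p (lift ord0 j) (lift ord0 i) >])
    (fun F => exists l, [/\ fiber_eq l,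
       exists2 i : 'I_n.+1, on_F1 (p (lift ord0 i))
                          & goes_through l (p (lift ord0 i))
     & F = [set i : 'I_n.+1 | goes_through l (p (lift ord0 i))]%SET])
    [set i : 'I_n.+1 | `[< proximate p (lift ord0 i) ord0 >]]%SET.

End OverPlane.

(* The divisor class group of the blowup of the plane at a configuration of N
   points is free on the classes of L^*, E_1^*, .., E_N^*, with intersection
   form diag(1, -1, .., -1); divisors are represented by their coordinates in
   this basis. *)
Section Divisors.
Variable N : nat.

Definition Lstar : 'rV[int]_N.+1 := delta_mx 0 ord0.

Definition Estar (i : 'I_N) : 'rV[int]_N.+1 := delta_mx 0 (lift ord0 i).

Definition intersection (D D' : 'rV[int]_N.+1) : int :=
  D 0 ord0 * D' 0 ord0 - \sum_(i < N) D 0 (lift ord0 i) * D' 0 (lift ord0 i).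

(* Class of the strict transform of a plane curve of degree d:
   d L^* minus the sum of the m_i E_i^*, where m_i is the multiplicity at p_i
   of the strict transform on the surface containing p_i. *)
Definition strict_class (k : closedFieldType) (p : 'I_N -> near_point k)
    (C : integral_curve k) : 'rV[int]_N.+1 :=
  (curve_deg C)%:Z *: Lstar
  - \sum_(i < N) (mult_at (curve_eq C) (p i))%:Z *: Estar i.

End Divisors.

(* Main.v *)
Require Import Defs.
From HB Require Import structures.
From mathcomp Require Import all_boot all_order all_algebra.
From mathcomp Require Import boolp classical_sets reals.
From mathcomp Require Import mpoly.
From mathcomp Require Import ring lra.
Import Order.TTheory GRing.Theory Num.Theory.

(* On the Hirzebruch surface, with m_i the multiplicities of C at the p_i, the
   strict transform of C has x = m_1 on the special section and y = deg C - m_1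
   on a fiber, and (x, y, m_2, ...) lies in the cone K: the inequalities for the
   section and the vertices are the proximity inequalities of C, those for the
   fibers are Bezout's theorem for C and a line through p_1.  Hence
   C~^2 = 2 x y + y^2 - sum m_i^2 >= - (a - 1) y^2, and y <= (iota L - tau E).C~.
   Both families of inequalities come from one statement: the multiplicities of
   a curve at the infinitely near points of a smooth branch add up to at most
   the order of contact with the branch, and the orders of contact at distinct
   points of a projective line are orders of zeros of one binary form.
   The value a exists because on K every m_i is at most y, so that the number of
   points blown up on the Hirzebruch surface is admissible. *)

Set Implicit Arguments.
Unset Strict Implicit.
Unset Printing Implicit Defensive.

Local Open Scope ring_scope.

(** The indices are grouped by the value of [u]. Inside a group the ranks [r i] are distinct, so the
    terms of the group are part of one partial sum of [w v]. In the applications [u] is a point of a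
    projective line, [r] the number of blowups above it and [b] the order of a zero there. *)
Lemma sum_fibered_le (I : finType) (T : eqType) (A : {set I})
    (u : I -> T) (r : I -> nat) (w : T -> nat -> nat) (b : T -> nat) :
  {in A &, forall i j, u i = u j -> r i = r j -> i = j} ->
  (forall v N, \sum_(s < N) w v s <= b v)%N ->
  (\sum_(i in A) w (u i) (r i)
     <= \sum_(v <- undup [seq u i | i <- enum A]) b v)%N.
Proof.
move=> inj_ur le_wb; set V := undup _.
have uV : uniq V by exact: undup_uniq.
have -> : (\sum_(i in A) w (u i) (r i)
  = \sum_(v <- V) \sum_(i in A | u i == v) w v (r i))%N.
  rewrite [RHS](exchange_big_dep (mem A)) /=; last by move=> v i _ /andP[].
  apply: eq_bigr => i iA.
  have uiV : u i \in V by rewrite mem_undup map_f // mem_enum.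
  rewrite (eq_bigl (pred1 (u i))); last by move=> v /=; rewrite iA eq_sym.
  by rewrite -big_filter filter_pred1_uniq // big_seq1.
(* [N] exceeds every rank in [A], so each term of the group occurs in the partial sum; each [s] is
   then hit by at most one index. *)
apply: leq_sum => v _; set N := (\max_(i in A) r i).+1.
apply: leq_trans (le_wb v N).
have -> : (\sum_(i in A | u i == v) w v (r i)
  = \sum_(i in A | u i == v) \sum_(s < N | s == r i :> nat) w v s)%N.
  apply: eq_bigr => i /andP[iA _].
  have ltr : (r i < N)%N by rewrite ltnS; apply: leq_bigmax_cond.
  by rewrite (big_pred1 (Ordinal ltr)).
rewrite (exchange_big_dep predT) //=; apply: leq_sum => s _.
rewrite sum_nat_const; set B := #|_|; suff : (B <= 1)%N.
  by move=> le1; rewrite -{2}[w v s]mul1n leq_mul2r le1 orbT.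
rewrite /B -ltnS ltnNge; apply/card_gt1P => -[i [j [iB jB]]]; case/negP.
move: iB jB; rewrite 2!unfold_in.
case/andP => /andP[iA /eqP ui] /eqP si /andP[/andP[jA /eqP uj] /eqP sj].
by apply/eqP/inj_ur => //; rewrite ?ui ?uj // -si -sj.
Qed.

(** * Orders of the zeros of a binary form, counted in two affine charts *)

Section BinaryForms.
Variable k : closedFieldType.
Implicit Types P Q : {poly k}.

(** [P] splits into linear factors, and the multiplicity of [c] is its number of occurrences in the
    list of roots; distinct elements of [S] count disjoint parts of this list. *)
Lemma sum_mup_le P (S : seq k) :
  P != 0 -> uniq S -> (\sum_(c <- S) mup c P <= (size P).-1)%N.
Proof.
move=> P0 uS; have [s defP] := closed_field_poly_normal P.
have lP0 : lead_coef P != 0 by rewrite lead_coef_eq0.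
rewrite defP size_scale // size_prod_XsubC /=.
have -> : (\sum_(c <- S) mup c (lead_coef P *: \prod_(z <- s) ('X - z%:P))
  = \sum_(c <- S) count_mem c s)%N.
  apply: eq_bigr => c _; rewrite -mul_polyC mupMr ?mu_prod_XsubC //.
  by rewrite rootC.
elim: s {defP} => [|z s IHs] /=; first by rewrite big1.
rewrite big_split /= -add1n leq_add //.
have -> : (\sum_(c <- S) (z == c) = count_mem z S)%N.
  rewrite -sum1_count [RHS]big_mkcond; apply: eq_bigr => c _ /=.
  by rewrite eq_sym; case: eqP.
by rewrite count_uniq_mem // leq_b1.
Qed.

Lemma Xn_dvd_mup P c n : P != 0 ->
  'X^n %| P \Po ('X + c%:P) -> (n <= mup c P)%N.
Proof.
move=> P0 /dvdpP[Q defP]; rewrite mup_geq //; apply/dvdpP.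
exists (Q \Po ('X - c%:P)).
have := congr1 (comp_poly ('X - c%:P)) defP.
rewrite -comp_polyA comp_polyM comp_polyD comp_polyX comp_polyC subrK comp_polyXr.
by rewrite comp_Xn_poly.
Qed.

(* P and Q are the dehomogenisations g(T, 1) and g(1, T) of a binary form g of
   degree d; the zero of g at [None] is the point at infinity of P. *)
Lemma binary_form_sum_le (d : nat) P Q (I : finType) (A : {set I})
    (u : I -> option k) (r : I -> nat) (w : option k -> nat -> nat) :
  P != 0 -> (size P <= d.+1)%N -> (forall i, (i <= d)%N -> Q`_(d - i) = P`_i) ->
  {in A &, forall i j, u i = u j -> r i = r j -> i = j} ->
  (forall c N, 'X^(\sum_(s < N) w (Some c) s) %| P \Po ('X + c%:P)) ->
  (forall N, 'X^(\sum_(s < N) w None s) %| Q) ->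
  (\sum_(i in A) w (u i) (r i) <= d)%N.
Proof.
move=> P0 szP revQ inj_ur wP wQ.
have sP : (0 < size P)%N by rewrite size_poly_gt0.
pose e := (size P).-1.
have le_ed : (e <= d)%N by rewrite /e -ltnS prednK.
(* This coefficient is the leading coefficient of [P], so [Q] vanishes at 0 to order at most
   [d - e]: the drop in the degree of [P] bounds the zero at infinity. *)
have Qe : Q`_(d - e) != 0 by rewrite revQ // -lead_coefE lead_coef_eq0.
have Q0 : Q != 0 by apply: contraNneq Qe => ->; rewrite coef0.
have muQ n : 'X^n %| Q -> (n <= d - e)%N.
  case/dvdpP => Q' defQ; rewrite leqNgt; apply: contra Qe => lt_n.
  by rewrite defQ coefMXn lt_n.
pose b v := if v is Some c then mup c P else (d - e)%N.
apply: leq_trans (sum_fibered_le (b := b) inj_ur _) _.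
  by case=> [c|] N /=; [apply: Xn_dvd_mup (wP c N) | apply: muQ (wQ N)].
set V := undup _.
have uV : uniq V by exact: undup_uniq.
(* As [V] has no repetition, [None] contributes [d - e] at most once, and the finite points
   contribute at most [e] together. *)
suff le_V : (\sum_(v <- V) b v <= \sum_(c <- pmap id V) mup c P + (d - e))%N.
  have uS : uniq (pmap id V) by apply: (pmap_uniq (g := Some)) => // -[].
  by apply: leq_trans le_V _; rewrite -[X in (_ <= X)%N](subnKC le_ed) leq_add2r sum_mup_le.
elim: V uV => [|v V IHV] /=; first by rewrite big_nil.
rewrite big_cons => /andP[vV /IHV{}IHV]; case: v vV => [c|] vV /=.
  by rewrite big_cons -addnA leq_add2l.
rewrite addnC leq_add2r big_seq [X in (_ <= X)%N]big_seq.
elim: V vV {IHV} => [|v V IHV] /=; first by rewrite !big_nil.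
case: v => [c|] //; rewrite inE /= => /IHV{}IHV.
by rewrite -!big_seq !big_cons leq_add2l !big_seq.
Qed.

End BinaryForms.

(** * Contact of a plane germ with a line through the origin, under blowups *)

Section LinearBranches.
Variable k : closedFieldType.
Implicit Types (f g : {mpoly k[2]}) (c u v : k) (d : option k).

Local Notation x := ('X_(@ord0 1) : {mpoly k[2]}).
Local Notation y := ('X_(@ord_max 1) : {mpoly k[2]}).

Definition peval n (h : n.-tuple {poly k}) : {mpoly k[n]} -> {poly k} :=
  mmap (@polyC k) (tnth h).

HB.instance Definition _ n (h : n.-tuple {poly k}) :=
  GRing.RMorphism.copy (@peval n h) (mmap (@polyC k) (tnth h)).

Lemma pevalC n (h : n.-tuple {poly k}) c : peval h c%:MP = c%:P.
Proof. exact: mmapC. Qed.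

Lemma pevalX n (h : n.-tuple {poly k}) i : peval h 'X_i = tnth h i.
Proof. by rewrite /peval mmapX mmap1U. Qed.

Lemma pevalE n (h : n.-tuple {poly k}) (p : {mpoly k[n]}) :
  peval h p = \sum_(m <- msupp p) p@_m *: \prod_(i < n) tnth h i ^+ m i.
Proof. by apply: eq_bigr => m _; rewrite mul_polyC. Qed.

Lemma peval_comp n l (h : l.-tuple {poly k}) (q : n.-tuple {mpoly k[l]})
    (p : {mpoly k[n]}) :
  peval h (p \mPo q) = peval [tuple of map (peval h) q] p.
Proof.
rewrite comp_mpolyE rmorph_sum pevalE; apply: eq_bigr => m _ /=.
rewrite -mul_mpolyC rmorphM /= pevalC mul_polyC rmorph_prod; congr (_ *: _).
by apply: eq_bigr => i _; rewrite rmorphXn /= tnth_map.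
Qed.

Lemma ord2E : lift ord0 (@ord0 0) = (@ord_max 1).
Proof. exact: val_inj. Qed.

Lemma tnth2_0 T (a b : T) : tnth [tuple a; b] ord0 = a.
Proof. by []. Qed.

Lemma tnth2_1 T (a b : T) : tnth [tuple a; b] ord_max = b.
Proof. by []. Qed.

Lemma peval2E (P Q : {poly k}) f :
  peval [tuple P; Q] f
    = \sum_(m <- msupp f) f@_m *: (P ^+ m ord0 * Q ^+ m ord_max).
Proof.
rewrite pevalE; apply: eq_bigr => m _.
by rewrite big_ord_recl big_ord1 ord2E tnth2_0 tnth2_1.
Qed.

Lemma mdeg2 (m : 'X_{1..2}) : mdeg m = (m ord0 + m ord_max)%N.
Proof. by rewrite mdegE big_ord_recl big_ord1 ord2E. Qed.

Lemma mult0_attained f :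
  f != 0 -> exists2 m, m \in msupp f & mdeg m = mult0 f.
Proof.
move=> f0; suff : mult0 f = msize f \/ exists2 m, m \in msupp f & mdeg m = mult0 f.
  case=> // eq_f; have lead_f := mlead_supp f0.
  by have := leq_trans (msize_mdeg_lt lead_f) (eq_leq (esym eq_f));
     rewrite ltnNge mult0_le.
rewrite /mult0; elim: (msupp f) => [|m s IHs]; first by left; rewrite big_nil.
rewrite big_cons; case: (leqP (mdeg m) (\big[minn/msize f]_(j <- s) mdeg j)) => le_m.
  by right; exists m; rewrite ?mem_head.
case: IHs => [->|[m' m's <-]]; [by left | right].
by exists m'; rewrite // inE m's orbT.
Qed.

Lemma mult00 : mult0 (0 : {mpoly k[2]}) = 0%N.
Proof. by rewrite /mult0 msupp0 big_nil msize0. Qed.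

Lemma mult0_homog f e : f \is e.-homog -> f != 0 -> mult0 f = e.
Proof. by move=> /dhomogP hf /mult0_attained[m /hf <- <-]. Qed.

Lemma strict_eq0 d : strict_eq (0 : {mpoly k[2]}) d = 0.
Proof. by rewrite /strict_eq msupp0 big_nil. Qed.

Lemma foldl_strict_eq0 s : foldl (@strict_eq k) 0 s = 0.
Proof. by elim: s => //= d s IHs; rewrite strict_eq0. Qed.

(** A curve missing the origin has multiplicity 0 there, so its strict transform is its pullback;
    both entries of the chart vanish at the origin, hence the constant term is unchanged. *)
Lemma strict_eq_nonvanishing f d :
  ~~ vanishes0 f -> ~~ vanishes0 (strict_eq f d).
Proof.
rewrite /vanishes0 => f0.
have mf : mult0 f = 0%N.
  by apply/eqP; rewrite -leqn0 -[X in (_ <= X)%N](@mdeg0 2) mult0_le // mcoeff_msupp.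
have := blowup_chart_strict_eq f d; rewrite mf expr0 mul1r => <-.
rewrite comp_mpolyEX raddf_sum /=.
rewrite (bigD1_seq 0%MM) ?msupp_uniq ?mcoeff_msupp //=.
rewrite comp_mpolyX big1 ?mcoeffZ ?mcoeff1 ?eqxx ?mulr1; last first.
  by move=> i _; rewrite mnm0E expr0.
rewrite big1 ?addr0 // => m m0; rewrite comp_mpolyX mcoeffZ.
have mcoeff0M (a b : {mpoly k[2]}) : (a * b)@_0 = a@_0 * b@_0.
  by rewrite rmorphM.
have X0 (i : 'I_2) : ('X_i : {mpoly k[2]})@_0 = 0.
  by rewrite mcoeffX -mdeg_eq0 mdeg1.
have chart0 i : (tnth (blowup_chart d) i)@_0 = 0.
  have [-> | ->] : i = ord0 \/ i = ord_max.
    by case: i => -[|[|i]] // lti; [left | right]; apply: val_inj.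
  - by case: d => [c|]; rewrite tnth2_0 ?mcoeff0M ?X0 ?mul0r.
  - by case: d => [c|]; rewrite tnth2_1 ?mcoeff0M ?X0 ?mul0r.
have [i mi] : exists i, m i != 0%N.
  apply/existsP; apply: contraNT m0; rewrite negb_exists => /forallP m0.
  by apply/eqP/mnmP => i; rewrite mnm0E; apply/eqP; have := m0 i; rewrite negbK.
rewrite rmorph_prod (bigD1 i) //= rmorphXn /= chart0 expr0n.
by rewrite (negPf mi) mul0r mulr0.
Qed.

Lemma foldl_strict_eq_nonvanishing f s :
  ~~ vanishes0 f -> ~~ vanishes0 (foldl (@strict_eq k) f s).
Proof. by elim: s f => //= d s IHs f /(strict_eq_nonvanishing d)/IHs. Qed.

(** The tangent direction of t |-> (u t, v t), in the coordinates used by [near_point]. *)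
Definition direction u v : option k := if u == 0 then None else Some (v / u).

(* The infinitely near points, r blowups above the origin, of the line through
   the origin with direction d: once blown up, a line y = c x becomes y = 0 and
   the line x = 0 stays x = 0. *)
Fixpoint branch d (r : nat) : seq (option k) :=
  if r is r'.+1 then d :: branch (if d is Some _ then Some 0 else None) r'
  else [::].

(** For (u, v) nonzero, the order at 0 of this polynomial is the order of contact of f = 0 with the
    line. *)
Definition along u v f : {poly k} := peval [tuple u *: 'X; v *: 'X] f.

(** In the chart at its own direction the line lifts to a coordinate axis, with parametrisation (u
    t, 0) or (0, v t); the identity is [blowup_chart_strict_eq] restricted to it. *)
Lemma along_strict_eq u v f :
  along u v f = ((if u == 0 then v else u) *: 'X) ^+ mult0 f
    * along u (if u == 0 then v else 0) (strict_eq f (direction u v)).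
Proof.
have := congr1 (peval [tuple u *: 'X; (if u == 0 then v else 0) *: 'X])
  (blowup_chart_strict_eq f (direction u v)).
rewrite rmorphM rmorphXn /= peval_comp /along /direction.
have [->|u0] := eqVneq u 0; rewrite /= !pevalX.
  rewrite tnth2_1 => <-; congr (peval _ _).
  by apply: val_inj; rewrite /= rmorphM /= !pevalX tnth2_0 tnth2_1 scale0r mul0r.
rewrite tnth2_0 => <-; congr (peval _ _); apply: val_inj; rewrite /=.
rewrite rmorphM rmorphD /= !pevalX tnth2_0 tnth2_1 pevalC scale0r add0r.
by rewrite mulrC mul_polyC scalerA divfK.
Qed.

(** Each blowup along the line splits off a power of ['X] equal to the current multiplicity, so
    these multiplicities add up to at most the order of contact. *)
Lemma along_dvd u v f N :
  'X^(\sum_(s < N) mult0 (foldl (@strict_eq k) f (branch (direction u v) s)))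
    %| along u v f.
Proof.
elim: N u v f => [|N IHN] u v f; first by rewrite big_ord0 dvd1p.
rewrite big_ord_recl along_strict_eq exprD dvdp_mul //.
  by rewrite exprZn -mul_polyC dvdp_mull.
(* The lifted line has direction [Some 0] or [None], which is how [branch] continues. *)
have := IHN u (if u == 0 then v else 0) (strict_eq f (direction u v)).
by rewrite /direction; case: eqVneq => [->|u0]; rewrite ?eqxx ?mul0r.
Qed.

End LinearBranches.

(** * Infinitely near points of linear germs and of exceptional curves *)

Section LinearGerms.
Variable k : closedFieldType.
Implicit Types (f g : {mpoly k[2]}) (a b c : k) (d : option k).

Local Notation x := ('X_(@ord0 1) : {mpoly k[2]}).
Local Notation y := ('X_(@ord_max 1) : {mpoly k[2]}).

Lemma mpolyX2_neq0 (i : 'I_2) : ('X_i : {mpoly k[2]}) != 0.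
Proof. by rewrite -msupp_eq0 msuppX. Qed.

Definition linear_germ a b : {mpoly k[2]} := a *: x + b *: y.

Lemma linear_germ_coef a b :
  ((linear_germ a b)@_U_(ord0) = a) * ((linear_germ a b)@_U_(ord_max) = b).
Proof.
by split; rewrite mcoeffD !mcoeffZ !mcoeffXU /= ?mulr0 ?mulr1 ?addr0 ?add0r.
Qed.

Lemma linear_germ_neq0 a b : (a != 0) || (b != 0) -> linear_germ a b != 0.
Proof.
apply: contraTneq => g0; have [ga gb] := linear_germ_coef a b.
by rewrite g0 !mcoeff0 in ga gb; rewrite -ga -gb eqxx.
Qed.

Lemma linear_germ_homog a b : linear_germ a b \is 1.-homog.
Proof. by rewrite rpredD // rpredZ // dhomogX /= mdeg1. Qed.

Lemma linear_germ_strict_eq a b d : (a != 0) || (b != 0) ->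
  strict_eq (linear_germ a b) d =
    if d is Some c then b *: y + (a + b * c)%:MP else a *: x + b%:MP.
Proof.
move=> ab0; have := blowup_chart_strict_eq (linear_germ a b) d.
rewrite (mult0_homog (linear_germ_homog a b)) ?linear_germ_neq0 // expr1.
rewrite comp_mpolyD !comp_mpolyZ !comp_mpolyXU.
case: d => [c|] /= def_s; apply: (mulfI (mpolyX2_neq0 _)); apply: etrans (esym def_s) _; rewrite -!mul_mpolyC.
  by rewrite mpolyCD mpolyCM; ring.
by ring.
Qed.

Lemma vanishes0_affine a c (i : 'I_2) : vanishes0 (a *: 'X_i + c%:MP) = (c == 0).
Proof.
by rewrite /vanishes0 mcoeffD mcoeffZ mcoeffX mnm1_eq0 mcoeffC eqxx mulr0 add0r mulr1.
Qed.

(* [direction b (- a)] is the tangent direction of a x + b y = 0. *)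
Lemma linear_germ_branch a b s : (a != 0) || (b != 0) ->
  vanishes0 (foldl (@strict_eq k) (linear_germ a b) s) ->
  s = branch (direction b (- a)) (size s).
Proof.
elim: s a b => //= d s IHs a b ab0 van_s.
(* Once a strict transform misses the point it misses all points above it, so the first direction
   [d] must be that of the germ: a + b c = 0, or b = 0 when [d] is [None]. *)
have: vanishes0 (strict_eq (linear_germ a b) d).
  by apply: contraTT van_s; apply: foldl_strict_eq_nonvanishing.
move: van_s; rewrite linear_germ_strict_eq // /direction.
case: d => [c|] van_s; rewrite vanishes0_affine => /eqP c0.
  have b0 : b != 0.
    by apply: contraTneq ab0 => b0; move: c0; rewrite b0 mul0r addr0 => ->; rewrite eqxx.
  rewrite (negPf b0); congr (_ :: _).
    congr Some; apply: (mulfI b0); rewrite mulrCA divff // mulr1.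
    by apply/eqP; rewrite -addr_eq0 addrC c0.
  rewrite [LHS](IHs 0 b) ?b0 ?orbT //.
    by rewrite /direction (negPf b0) oppr0 mul0r.
  by move: van_s; rewrite c0 /linear_germ scale0r add0r addr0.
rewrite c0 eqxx; congr (_ :: _).
have a0 : a != 0 by move: ab0; rewrite c0 eqxx orbF.
rewrite [LHS](IHs a 0) ?a0 //; first by rewrite /direction eqxx.
by move: van_s; rewrite c0 /linear_germ scale0r.
Qed.

(** In its chart the exceptional curve is a coordinate axis: x = 0, of direction [None], or y = 0,
    of direction [Some 0]. *)
Lemma exceptional_branch d s :
  vanishes0 (foldl (@strict_eq k) (exceptional_eq d) s) ->
  s = branch (if d is Some _ then None else Some 0) (size s).
Proof.
have -> : exceptional_eq d =
    if d is Some _ then linear_germ 1 0 else linear_germ 0 1.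
  by case: d => [c|]; rewrite /linear_germ !(scale0r, scale1r, addr0, add0r).
case: d => [c|] van_s; rewrite [LHS](linear_germ_branch _ van_s) ?oner_eq0 ?orbT //.
  by rewrite /direction eqxx.
by rewrite /direction oner_eq0 oppr0 mul0r.
Qed.

End LinearGerms.

(** * Binary forms in two variables and the proximity inequality *)

Section Dehomogenisation.
Variable k : closedFieldType.
Implicit Types (f g : {mpoly k[2]}).

Lemma mnm2E (m : 'X_{1..2}) i j : m ord0 = i -> m ord_max = j ->
  m = [multinom [tuple i; j]].
Proof.
move=> mi mj; apply/mnmP => h; rewrite multinomE.
by case: h => -[|[|h]] // lth; [rewrite -mi | rewrite -mj]; congr (m _); apply: val_inj.
Qed.

(** In a homogeneous polynomial of degree [e], one exponent determines the monomial, so setting a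
    variable to 1 merges no coefficients. *)
Lemma coef_dehomog g e i : g \is e.-homog -> (i <= e)%N ->
  ((peval [tuple 1; 'X] g)`_i = g@_[multinom [tuple (e - i)%N; i]]) *
  ((peval [tuple 'X; 1] g)`_i = g@_[multinom [tuple i; (e - i)%N]]).
Proof.
move=> /dhomogP hg le_ie.
have aux (h : 'X_{1..2} -> nat) (M : 'X_{1..2}) :
    (forall m, mdeg m = e -> (i == h m) = (m == M)) ->
  (\sum_(m <- msupp g) g@_m *: 'X^(h m))`_i = g@_M.
  move=> hM; rewrite coef_sum big_seq.
  rewrite (eq_bigr (fun m => if m == M then g@_m else 0)); last first.
    move=> m /hg /hM; rewrite coefZ coefXn => ->.
    by case: eqP; rewrite ?mulr1 ?mulr0.
  rewrite -big_seq -big_mkcond -big_filter /=.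
  have [M_g|M_g] := boolP (M \in msupp g).
    by rewrite filter_pred1_uniq // ?msupp_uniq // big_seq1.
  rewrite (eq_in_filter (a2 := pred0)) ?filter_pred0 ?big_nil ?memN_msupp_eq0 //.
  by move=> m m_g; apply: contraNF M_g => /eqP <-.
split; rewrite peval2E.
  under eq_bigr => m _ do rewrite expr1n mul1r.
  apply: (aux (fun m => m ord_max)) => m def_e.
  apply/eqP/eqP => [def_i|->]; last by rewrite multinomE.
  by apply: mnm2E => //; rewrite def_i -def_e mdeg2 addnK.
under eq_bigr => m _ do rewrite expr1n mulr1.
apply: (aux (fun m => m ord0)) => m def_e.
apply/eqP/eqP => [def_i|->]; last by rewrite multinomE.
by apply: mnm2E => //; rewrite def_i -def_e mdeg2 addKn.
Qed.

Lemma size_dehomog g e : g \is e.-homog -> leq (size (peval [tuple 1; 'X] g)) e.+1.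
Proof.
move=> /dhomogP hg; rewrite peval2E big_seq.
apply: (big_ind (fun P : {poly k} => leq (size P) e.+1)) => [|P Q sP sQ|m m_g].
- by rewrite size_poly0.
- by apply: leq_trans (size_polyD _ _) _; rewrite geq_max sP.
have def_e : mdeg m = e := hg m m_g.
rewrite expr1n mul1r; apply: leq_trans (size_scale_leq _ _) _.
by rewrite size_polyXn ltnS -def_e mdeg2 leq_addl.
Qed.

Lemma dehomog_eq0 g e : g \is e.-homog -> peval [tuple 1; 'X] g = 0 -> g = 0.
Proof.
move=> hg P0; apply/mpolyP => m; rewrite mcoeff0.
have [def_e|/(dhomog_nemf_coeff hg) //] := eqVneq (mdeg m) e.
have le_me : (m ord_max <= e)%N by rewrite -def_e mdeg2 leq_addl.
rewrite (_ : m = [multinom [tuple (e - m ord_max)%N; m ord_max]]).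
  by rewrite -(coef_dehomog hg le_me) P0 coef0.
by apply: mnm2E => //; rewrite -def_e mdeg2 addnK.
Qed.

Lemma form_sum_le g e (I : finType) (A : {set I})
    (u : I -> option k) (r : I -> nat) (w : option k -> nat -> nat) :
  g \is e.-homog -> g != 0 ->
  {in A &, forall i j, u i = u j -> r i = r j -> i = j} ->
  (forall c N, 'X^(\sum_(s < N) w (Some c) s)
     %| peval [tuple 1; 'X + c%:P] g) ->
  (forall N, 'X^(\sum_(s < N) w None s) %| peval [tuple 'X; 1] g) ->
  (\sum_(i in A) w (u i) (r i) <= e)%N.
Proof.
move=> hg g0 inj_ur wP wQ.
apply: (binary_form_sum_le (P := peval [tuple 1; 'X] g)
                           (Q := peval [tuple 'X; 1] g)) => //.
- by apply: contraNneq g0 => /(dehomog_eq0 hg) ->.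
- exact: size_dehomog.
- move=> i le_ie; rewrite (coef_dehomog hg le_ie) (coef_dehomog hg (leq_subr i e)).
  by rewrite subKn.
move=> c N; move: (wP c N); congr (_ %| _).
rewrite !peval2E [RHS]raddf_sum; apply: eq_bigr => m _ /=.
by rewrite !expr1n !mul1r comp_polyZ comp_Xn_poly.
Qed.

(* The leading form of f cuts out on the exceptional curve the points of the
   strict transform, with their intersection multiplicities. *)
Lemma proximity_inequality f (I : finType) (A : {set I})
    (d : I -> option k) (s : I -> seq (option k)) :
  {in A, forall i, vanishes0 (foldl (@strict_eq k) (exceptional_eq (d i)) (s i))} ->
  {in A &, forall i j, d i = d j -> s i = s j -> i = j} ->
  (\sum_(i in A) mult0 (foldl (@strict_eq k) f (d i :: s i)) <= mult0 f)%N.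
Proof.
move=> vanA injA; have [->|f0] := eqVneq f 0.
  by rewrite big1 // => i _; rewrite foldl_strict_eq0 mult00.
pose next (v : option k) : option k := if v is Some _ then None else Some 0.
pose w v r := mult0 (foldl (@strict_eq k) f (v :: branch (next v) r)).
have sA i : i \in A -> s i = branch (next (d i)) (size (s i)).
  by move=> /vanA /exceptional_branch.
rewrite (eq_bigr (fun i => w (d i) (size (s i)))); last first.
  by move=> i /sA; rewrite /w => <-.
(* The leading form of [f], of degree [mult0 f], is the binary form whose zeros are counted. *)
pose g := pihomog mdeg (mult0 f) f.
have gE (a b : {poly k}) : peval [tuple a; b] g =
    \sum_(m <- msupp f | mdeg m == mult0 f) f@_m *: (a ^+ m ord0 * b ^+ m ord_max).
  rewrite /g pihomogE rmorph_sum /=; apply: eq_bigr => m _.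
  rewrite -mul_mpolyC rmorphM /= pevalC mul_polyC; congr (_ *: _).
  rewrite /peval mmapX /mmap1 big_ord_recl big_ord1 ord2E.
  by rewrite tnth2_0 tnth2_1.
apply: (form_sum_le (g := g)).
- exact: pihomogP.
- have [m mf m_min] := mult0_attained f0.
  apply: contraTneq (mf) => g0; rewrite mcoeff_msupp negbK.
  have := congr1 (mcoeff m) g0; rewrite /g pihomogE raddf_sum big_mkcond /=.
  rewrite (bigD1_seq m) ?msupp_uniq //= m_min eqxx mcoeffZ mcoeffX eqxx mulr1.
  rewrite big1 ?addr0 ?mcoeff0 => [->//|m' /negPf m'm].
  by case: ifP => // _; rewrite mcoeffZ mcoeffX m'm mulr0.
- by move=> i j iA jA eq_d eq_s; apply: injA => //; rewrite sA // [RHS]sA // eq_d eq_s.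
(* On the exceptional curve x = 0 only the monomials of degree [mult0 f] survive, so the strict
   transform restricts to [g] at (1, X + c). *)
- move=> c N; have := along_dvd 0 1 (strict_eq f (Some c)) N.
  rewrite /direction eqxx /along scale0r scale1r; congr (_ %| _).
  rewrite gE /strict_eq rmorph_sum [RHS]big_mkcond /=; apply: eq_big_seq => m m_f.
  rewrite [mdeg m == _]eqn_leq mult0_le // andbT -subn_eq0.
  rewrite -mul_mpolyC !(rmorphM, rmorphXn) rmorphD /= !pevalC !pevalX tnth2_0 tnth2_1.
  rewrite expr0n expr1n mul1r mul_polyC.
  by case: (_ == 0%N); rewrite ?mul1r // mul0r scaler0.
move=> N; have := along_dvd 1 0 (strict_eq f None) N.
rewrite /direction oner_eq0 mul0r /along scale0r scale1r; congr (_ %| _).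
rewrite gE /strict_eq rmorph_sum [RHS]big_mkcond /=; apply: eq_big_seq => m m_f.
rewrite [mdeg m == _]eqn_leq mult0_le // andbT -subn_eq0.
rewrite -mul_mpolyC !(rmorphM, rmorphXn) /= !pevalC !pevalX tnth2_0 tnth2_1.
rewrite expr0n expr1n mulr1 mul_polyC.
by case: (_ == 0%N); rewrite ?mulr1 // mulr0 scaler0.
Qed.

End Dehomogenisation.

(** * Parametrisation of the lines of the plane *)

Section Lines.
Variable k : closedFieldType.
Implicit Types (a b c e t : k) (F l : {mpoly k[3]}) (d : option k).
Implicit Type (q : plane_point k).

Local Notation x := ('X_(@ord0 1) : {mpoly k[2]}).
Local Notation y := ('X_(@ord_max 1) : {mpoly k[2]}).
Local Notation X := ('X_(@Ordinal 3 0 isT) : {mpoly k[3]}).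
Local Notation Y := ('X_(@Ordinal 3 1 isT) : {mpoly k[3]}).
Local Notation Z := ('X_(@Ordinal 3 2 isT) : {mpoly k[3]}).

Definition linear_form a b c : {mpoly k[3]} := a *: X + b *: Y + c *: Z.

Lemma linear_formP l : l \is 1.-homog -> exists a b c, l = linear_form a b c.
Proof.
move=> l1; exists l@_U_(@Ordinal 3 0 isT), l@_U_(@Ordinal 3 1 isT), l@_U_(@Ordinal 3 2 isT).
apply/mpolyP => m; have [/eqP/mdeg1P[i /eqP ->]|m1] := eqVneq (mdeg m) 1%N.
  rewrite !mcoeffD !mcoeffZ !mcoeffXU.
  by case: i => -[|[|[|i]]] // lti; rewrite -?val_eqE /= ?mulr0 ?mulr1 ?addr0 ?add0r;
     congr (l@_U_(_)); apply: val_inj.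
rewrite (dhomog_nemf_coeff l1 m1) (@dhomog_nemf_coeff _ _ mdeg 1) //.
by rewrite !rpredD // rpredZ // dhomogX /= mdeg1.
Qed.

Lemma local_form_linear q a b c : local_form q (linear_form a b c) =
  match q with
  | PAff a' b' => linear_germ a b + (a * a' + b * b' + c)%:MP
  | PInf a' => linear_germ a c + (a * a' + b)%:MP
  | PTop => linear_germ b c + a%:MP
  end.
Proof.
rewrite /linear_germ.
by case: q => [a' b'|a'|]; rewrite /= !comp_mpolyD !comp_mpolyZ !comp_mpolyXU /=
   -!mul_mpolyC ?mpolyCD ?mpolyCM; ring.
Qed.

Lemma direction_scale s u v : s != 0 -> direction (s * u) (s * v) = direction u v :> option k.
Proof.
by move=> s0; rewrite /direction mulf_eq0 (negPf s0) /= -mulf_div divff // mul1r.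
Qed.

Lemma affine_germ_branch a b e s :
  vanishes0 (foldl (@strict_eq k) (linear_germ a b + e%:MP) s) ->
  e = 0 /\ ((a != 0) || (b != 0) -> s = branch (direction b (- a)) (size s)).
Proof.
move=> van_s; have e0 : e = 0.
  have: vanishes0 (linear_germ a b + e%:MP).
    by apply: contraTT van_s; apply: foldl_strict_eq_nonvanishing.
  by rewrite /vanishes0 !mcoeffD !mcoeffZ !mcoeffX !mnm1_eq0 mcoeffC eqxx !mulr0 !add0r mulr1 => /eqP.
split=> // ab0; apply: linear_germ_branch => //.
by move: van_s; rewrite e0 addr0.
Qed.

(** Congruence modulo [l] is compatible with sums and products, hence with substitution into [F]. *)
Lemma comp_mpoly_congr l (f g : 3.-tuple {mpoly k[3]}) F :
  (forall i, exists G, tnth f i - tnth g i = l * G) ->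
  exists G, (F \mPo f) - (F \mPo g) = l * G.
Proof.
move=> fg; pose K (h1 h2 : {mpoly k[3]}) := exists G, h1 - h2 = l * G.
have KM h1 h2 h3 h4 : K h1 h2 -> K h3 h4 -> K (h1 * h3) (h2 * h4).
  move=> [G eG] [G' eG']; exists (h1 * G' + G * h4).
  by rewrite mulrDr mulrCA -eG' mulrA -eG; ring.
suff: K (F \mPo f) (F \mPo g) by [].
rewrite !comp_mpolyE; apply: (big_ind2 K) => [|h1 h2 h3 h4 [G eG] [G' eG']|m _].
- by exists 0; rewrite subrr mulr0.
- by exists (G + G'); rewrite mulrDr -eG -eG'; ring.
have [G eG] : K (\prod_(i < 3) tnth f i ^+ m i) (\prod_(i < 3) tnth g i ^+ m i).
  apply: (big_ind2 K) => // [|i _]; first by exists 0; rewrite subrr mulr0.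
  elim: (m i) => [|j IHj]; first by exists 0; rewrite subrr mulr0.
  by rewrite !exprS; apply: KM.
by exists (F@_m *: G); rewrite -scalerBr eG scalerAr.
Qed.

Lemma comp_mpolyA n i j (f : n.-tuple {mpoly k[i]}) (g : i.-tuple {mpoly k[j]})
    (p : {mpoly k[n]}) :
  (p \mPo f) \mPo g = p \mPo [tuple of map (comp_mpoly g) f].
Proof.
rewrite [p \mPo f]comp_mpolyE [RHS]comp_mpolyE raddf_sum; apply: eq_bigr => m _ /=.
rewrite comp_mpolyZ rmorph_prod; congr (_ *: _); apply: eq_bigr => h _.
by rewrite rmorphXn /= tnth_map.
Qed.

Lemma dhomog_comp F n (f : 3.-tuple {mpoly k[2]}) :
  (forall i, tnth f i \is 1.-homog) -> F \is n.-homog -> F \mPo f \is n.-homog.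
Proof.
move=> f1 /dhomogP hF; rewrite comp_mpolyE big_seq; apply: rpred_sum => m /hF def_n.
apply: rpredZ; have {}def_n : mdeg m = n := def_n.
rewrite -def_n mdegE; elim/big_ind2: _ => [|? ? ? ?|i _].
- exact: dhomog1.
- exact: dhomogM.
by have := dhomogMn (m i) (f1 i); rewrite mul1n.
Qed.

(* The line is the image of phi; the point with parameter t is the image of
   (1 : t), the point with parameter [None] that of (0 : 1). *)
Definition parametrises l (phi : 3.-tuple {mpoly k[2]}) (pt : option k -> plane_point k)
    (param : plane_point k -> option k) (dir : option k -> k * k) :=
  [/\ forall i, tnth phi i \is 1.-homog,
      forall F t, peval [tuple 1; 'X + t%:P] (F \mPo phi)
        = along (dir (Some t)).1 (dir (Some t)).2 (local_form (pt (Some t)) F),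
      forall F, peval [tuple 'X; 1] (F \mPo phi)
        = along (dir None).1 (dir None).2 (local_form (pt None) F),
      forall q s, goes_through l (q, s) -> pt (param q) = q /\
        s = branch (direction (dir (param q)).1 (dir (param q)).2) (size s)
    & forall F, F \mPo phi = 0 -> exists G, F = l * G].

(** Going to the line by [g] and back by [f] is the identity modulo [l], so [F] is congruent to the
    pullback by [g] of its zero restriction. *)
Lemma divides_of_retract l F (f : 3.-tuple {mpoly k[2]}) (g : 2.-tuple {mpoly k[3]}) :
  (forall i, exists G, 'X_i - (tnth f i \mPo g) = l * G) ->
  F \mPo f = 0 -> exists G, F = l * G.
Proof.
move=> fg F0; have [|G eG] := @comp_mpoly_congr l [tuple 'X_i | i < 3]
  [tuple of map (comp_mpoly g) f] F.
  by move=> i; rewrite tnth_mktuple tnth_map.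
by exists G; rewrite -eG comp_mpoly_id -comp_mpolyA F0 comp_mpoly0 subr0.
Qed.

Local Ltac peval_tac := rewrite /along peval_comp /local_form peval_comp;
  congr (peval _ _); apply: val_inj;
  rewrite /= ?linearD ?linearZ /= ?rmorphD /= -?mul_mpolyC ?rmorphM /= ?pevalC ?pevalX
    ?tnth2_0 ?tnth2_1 ?rmorph1 -?mul_polyC ?polyCD ?polyCM ?polyC1 ?polyC0;
  congr [:: _; _; _]; ring.

Lemma forall_ord3 (P : 'I_3 -> Prop) :
  P (@Ordinal 3 0 isT) -> P (@Ordinal 3 1 isT) -> P (@Ordinal 3 2 isT) -> forall i, P i.
Proof.
move=> P0 P1 P2 -[[|[|[|i]]] // lti].
- by rewrite (_ : Ordinal lti = Ordinal (isT : 0 < 3)%N) //; apply: val_inj.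
- by rewrite (_ : Ordinal lti = Ordinal (isT : 1 < 3)%N) //; apply: val_inj.
by rewrite (_ : Ordinal lti = Ordinal (isT : 2 < 3)%N) //; apply: val_inj.
Qed.

Lemma linear_form_divides (l h : {mpoly k[3]}) e : e != 0 -> l = e *: h ->
  exists G, h = l * G.
Proof.
move=> e0 ->; exists (e^-1)%:MP.
by rewrite mulrC mul_mpolyC scalerA mulVf // scale1r.
Qed.

(** The equation is solved for X, the parameter is Y / Z and [None] is the point with Z = 0; [dir]
    is the velocity of the parametrisation in the affine chart at each point. *)
Lemma parametrises_X a b c : a != 0 ->
  exists phi pt param dir, parametrises (linear_form a b c) phi pt param dir.
Proof.
move=> a0; pose b' := - (b / a); pose c' := - (c / a).
have ab' : a * b' = - b by rewrite mulrN mulrC divfK.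
have ac' : a * c' = - c by rewrite mulrN mulrC divfK.
exists [tuple b' *: y + c' *: x; y; x].
exists (fun v => if v is Some t then PAff (b' * t + c') t else PInf b').
exists (fun q => if q is PAff _ t then Some t else None).
exists (fun v => if v is Some _ then (b', 1) else (c', 1)).
split.
- by apply: forall_ord3; rewrite ?[tnth _ _]/= ?rpredD ?rpredZ ?dhomogX /= ?mdeg1.
- by move=> F t; peval_tac.
- by move=> F; peval_tac.
- move=> q s; rewrite /goes_through /strict_eq_at local_form_linear.
  case: q => [a1 b1|a1|] /= /affine_germ_branch[e0 germ_s].
  + split; last first.
      rewrite -(direction_scale b' 1 (s := - a)) ?oppr_eq0 // mulr1 mulNr ab' opprK.
      by apply: germ_s; rewrite a0.
    congr PAff; apply: (mulfI a0); rewrite mulrDr mulrA ab' ac' mulNr -opprD.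
    by apply/eqP; rewrite eq_sym -addr_eq0 addrA e0.
  + split; last first.
      rewrite -(direction_scale c' 1 (s := - a)) ?oppr_eq0 // mulr1 mulNr ac' opprK.
      by apply: germ_s; rewrite a0.
    congr PInf; apply: (mulfI a0); rewrite ab'.
    by apply/eqP; rewrite eq_sym -addr_eq0 e0.
  + by rewrite e0 eqxx in a0.
move=> F; apply: (@divides_of_retract _ _ _ [tuple Z; Y]); apply: forall_ord3.
- apply: (linear_form_divides a0); rewrite [tnth _ _]/= comp_mpolyD !comp_mpolyZ !comp_mpolyXU /=.
  by rewrite scalerBr scalerDr !scalerA ab' ac' !scaleNr -opprD opprK addrA.
- by exists 0; rewrite [tnth _ _]/= comp_mpolyXU subrr mulr0.
by exists 0; rewrite [tnth _ _]/= comp_mpolyXU subrr mulr0.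
Qed.

(** Here the equation is solved for Y and the parameter is X / Z. *)
Lemma parametrises_Y b c : b != 0 ->
  exists phi pt param dir, parametrises (linear_form 0 b c) phi pt param dir.
Proof.
move=> b0; pose c' := - (c / b).
have bc' : b * c' = - c by rewrite mulrN mulrC divfK.
exists [tuple y; c' *: x; x].
exists (fun v => if v is Some t then PAff t c' else PTop).
exists (fun q => if q is PAff t _ then Some t else None).
exists (fun v => if v is Some _ then (1, 0) else (c', 1)).
split.
- by apply: forall_ord3; rewrite ?[tnth _ _]/= ?rpredD ?rpredZ ?dhomogX /= ?mdeg1.
- by move=> F t; peval_tac.
- by move=> F; peval_tac.
- move=> q s; rewrite /goes_through /strict_eq_at local_form_linear.
  case: q => [a1 b1|a1|] /= /affine_germ_branch[e0 germ_s].
  + split; last first.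
      rewrite -(direction_scale 1 0 b0) mulr1 mulr0 -[X in direction _ X]oppr0.
      by apply: germ_s; rewrite b0 orbT.
    congr PAff; apply: (mulfI b0); rewrite bc'.
    by apply/eqP; rewrite eq_sym -addr_eq0 -[X in X == _]add0r -[X in X + _](mul0r a1) addrA e0.
  + by rewrite mul0r add0r in e0; rewrite e0 eqxx in b0.
  + split=> //; rewrite -(direction_scale c' 1 (s := - b)) ?oppr_eq0 // mulr1 mulNr bc' opprK.
    by apply: germ_s; rewrite b0.
move=> F; apply: (@divides_of_retract _ _ _ [tuple Z; X]); apply: forall_ord3.
- by exists 0; rewrite [tnth _ _]/= comp_mpolyXU subrr mulr0.
- apply: (linear_form_divides b0); rewrite [tnth _ _]/= !comp_mpolyZ !comp_mpolyXU /=.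
  by rewrite scalerBr scalerA bc' scaleNr opprK /linear_form scale0r add0r.
by exists 0; rewrite [tnth _ _]/= comp_mpolyXU subrr mulr0.
Qed.


(** This is the line at infinity Z = 0, with parameter X / Y. *)
Lemma parametrises_Z c : c != 0 ->
  exists phi pt param dir, parametrises (linear_form 0 0 c) phi pt param dir.
Proof.
move=> c0; exists [tuple y; x; 0].
exists (fun v => if v is Some t then PInf t else PTop).
exists (fun q => if q is PInf t then Some t else None).
exists (fun=> (1, 0)).
split.
- by apply: forall_ord3; rewrite ?[tnth _ _]/= ?dhomog0 ?dhomogX /= ?mdeg1.
- by move=> F t; peval_tac.
- by move=> F; peval_tac.
- move=> q s; rewrite /goes_through /strict_eq_at local_form_linear.
  case: q => [a1 b1|a1|] /= /affine_germ_branch[e0 germ_s].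
  + by rewrite !mul0r !add0r in e0; rewrite e0 eqxx in c0.
  + split=> //; rewrite -(direction_scale 1 0 c0) mulr1 mulr0 -[X in direction _ X]oppr0.
    by apply: germ_s; rewrite c0 orbT.
  + split=> //; rewrite -(direction_scale 1 0 c0) mulr1 mulr0 -[X in direction _ X]oppr0.
    by apply: germ_s; rewrite c0 orbT.
move=> F; apply: (@divides_of_retract _ _ _ [tuple Y; X]); apply: forall_ord3.
- by exists 0; rewrite [tnth _ _]/= comp_mpolyXU subrr mulr0.
- by exists 0; rewrite [tnth _ _]/= comp_mpolyXU subrr mulr0.
apply: (linear_form_divides c0); rewrite [tnth _ _]/= comp_mpoly0 subr0.
by rewrite /linear_form !scale0r !add0r.
Qed.


Lemma line_parametrisation l : l \is 1.-homog -> l != 0 ->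
  exists phi pt param dir, parametrises l phi pt param dir.
Proof.
move=> /linear_formP[a [b [c ->]]] l0.
have [a0|] := eqVneq a 0; last exact: parametrises_X.
have [b0|] := eqVneq b 0; last by rewrite a0; apply: parametrises_Y.
rewrite a0 b0; apply: parametrises_Z; apply: contraNneq l0 => c0.
by rewrite a0 b0 c0 /linear_form !scale0r !addr0.
Qed.

End Lines.

(** * Intersection of a plane curve with a line *)

Section Curves.
Variable k : closedFieldType.
Implicit Types (F l G : {mpoly k[3]}).

(* Bezout's theorem for a curve and a line not contained in it, infinitely near
   points included. *)
Lemma sum_mult_line_le F l n (I : finType) (A : {set I}) (p : I -> near_point k) :
  F \is n.-homog -> l \is 1.-homog -> l != 0 -> ~ (exists G, F = l * G) ->
  {in A &, injective p} -> {in A, forall i, goes_through l (p i)} ->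
  (\sum_(i in A) mult_at F (p i) <= n)%N.
Proof.
move=> hF hl l0 ndvd injp pA.
have [phi [pt [param [dir [phi1 phiS phiN onl dvdl]]]]] := line_parametrisation hl l0.
pose w v r := mult0 (foldl (@strict_eq k) (local_form (pt v) F)
  (branch (direction (dir v).1 (dir v).2) r)).
(* A point on the line is determined by its parameter and its number of blowups, which provides the
   injectivity required by [form_sum_le]. *)
have onA i : i \in A -> p i = (pt (param (p i).1),
    branch (direction (dir (param (p i).1)).1 (dir (param (p i).1)).2) (size (p i).2)).
  by move=> /pA; case: (p i) => q s /onl[/= -> <-].
rewrite (eq_bigr (fun i => w (param (p i).1) (size (p i).2))); last first.
  by move=> i /onA def_p; rewrite {1}def_p.
apply: (form_sum_le (g := F \mPo phi)).
- exact: dhomog_comp.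
- by apply/eqP => /dvdl.
- move=> i j iA jA eq_u eq_r; apply: injp => //.
  by rewrite onA // [RHS]onA // eq_u eq_r.
- by move=> c N; rewrite phiS; apply: along_dvd.
by move=> N; rewrite phiN; apply: along_dvd.
Qed.

Lemma msupp_scale (c : k) n (p : {mpoly k[n]}) : c != 0 ->
  msupp (c *: p) =i msupp p.
Proof. by move=> c0 m; rewrite !mcoeff_msupp mcoeffZ mulf_eq0 (negPf c0). Qed.

Lemma mult0_unit_scale (c : k) (f : {mpoly k[2]}) : c != 0 -> mult0 (c *: f) = mult0 f.
Proof.
move=> c0; have [->|f0] := eqVneq f 0; first by rewrite scaler0.
have cf0 : c *: f != 0 by rewrite scaler_eq0 negb_or c0.
have [m mf m_min] := mult0_attained f0.
have [m' mf' m_min'] := mult0_attained cf0.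
apply/eqP; rewrite eqn_leq -{1}m_min -{2}m_min' !mult0_le //.
  by rewrite -(msupp_scale f c0).
by rewrite msupp_scale.
Qed.

Lemma strict_eq_scale (c : k) f d : c != 0 ->
  strict_eq (c *: f) d = c *: strict_eq f d.
Proof.
move=> c0; have := blowup_chart_strict_eq (c *: f) d.
rewrite mult0_unit_scale // comp_mpolyZ blowup_chart_strict_eq scalerAr => eq_s.
have e0 : exceptional_eq d ^+ mult0 f != 0.
  by rewrite expf_neq0 //; case: d {eq_s} => [?|]; apply: mpolyX2_neq0.
exact/esym/(mulfI e0).
Qed.

Lemma goes_through_scale (c : k) F q : c != 0 ->
  goes_through (c *: F) q = goes_through F q.
Proof.
move=> c0; rewrite /goes_through /strict_eq_at.
have -> : local_form q.1 (c *: F) = c *: local_form q.1 F.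
  by case: q.1 => *; rewrite /= comp_mpolyZ.
elim: q.2 (local_form _ _) => [|d s IHs] f /=.
  by rewrite /vanishes0 mcoeffZ mulf_eq0 (negPf c0).
by rewrite strict_eq_scale.
Qed.

Lemma mpoly_unitP n (p : {mpoly k[n]}) : p \is a GRing.unit ->
  exists2 c, c != 0 & p = c%:MP.
Proof.
by case/andP=> /eqP def_p u0; exists p@_0; rewrite // -unitfE.
Qed.

(** By irreducibility one factor of l * G is a unit. It is not [l], whose constant term is 0, so the
    equation would be a scalar multiple of [l] and the curve a line through [q]. *)
Lemma curve_line_or_ndvd (C : integral_curve k) l q :
  l \is 1.-homog -> l != 0 -> goes_through l q ->
  ~ line_through C q -> ~ exists G, curve_eq C = l * G.
Proof.
move=> hl l0 lq nC [G defC]; apply: nC.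
have [/mpoly_unitP[c c0 def_l]|/mpoly_unitP[c c0 defG]] := curve_irreducible defC.
  case/eqP: c0; have := dhomog_nemf_coeff hl (m := 0%MM).
  by rewrite def_l mcoeffC eqxx mulr1 => -> //=; rewrite mdeg0.
move: defC; rewrite defG mulrC mul_mpolyC => defC; split.
  have := curve_homog C; rewrite defC => hC.
  apply: (dhomog_uniq _ hC); last exact: dhomogZ.
  by rewrite -defC curve_neq0.
by rewrite defC goes_through_scale.
Qed.

End Curves.

(** * Lines through two points, or through a point with a given tangent *)

Section Fibers.
Variable k : closedFieldType.
Implicit Types (a b c : k) (q P Q : plane_point k).

Definition coords q : k * k * k :=
  match q with
  | PAff a b => (a, b, 1)
  | PInf a => (a, 1, 0)
  | PTop => (1, 0, 0)
  end.

Lemma linear_form_homog a b c : linear_form a b c \is 1.-homog.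
Proof. by rewrite !rpredD // rpredZ // dhomogX /= mdeg1. Qed.

Lemma linear_form_neq0 a b c : (a, b, c) != (0, 0, 0) -> linear_form a b c != 0.
Proof.
apply: contraNneq => l0.
have coefU (i : 'I_3) := congr1 (mcoeff U_(i)) l0.
have := coefU (Ordinal (isT : 0 < 3)%N); have := coefU (Ordinal (isT : 1 < 3)%N).
have := coefU (Ordinal (isT : 2 < 3)%N).
rewrite !mcoeffD !mcoeffZ !mcoeffXU !mcoeff0 /= ?(mulr0, mulr1, addr0, add0r).
by move=> -> -> ->.
Qed.

Lemma vanishes0_germ a b c : vanishes0 (linear_germ a b + c%:MP) = (c == 0).
Proof.
by rewrite /vanishes0 !mcoeffD !mcoeffZ !mcoeffX !mnm1_eq0 mcoeffC eqxx !mulr0 !add0r mulr1.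
Qed.

Lemma goes_through_plane_point q a b c :
  goes_through (linear_form a b c) (q, [::])
  = (a * (coords q).1.1 + b * (coords q).1.2 + c * (coords q).2 == 0).
Proof.
rewrite /goes_through /strict_eq_at local_form_linear.
by case: q => [a1 b1|a1|]; rewrite /= vanishes0_germ ?mulr1 ?mulr0 ?addr0.
Qed.

(** The coefficients are the cross product of the two coordinate vectors; it vanishes only when the
    normalised points coincide. *)
Lemma line_through_points P Q : P <> Q ->
  exists l, [/\ l \is 1.-homog, l != 0,
                goes_through l (P, [::]) & goes_through l (Q, [::])].
Proof.
move=> PQ; set u := coords P; set v := coords Q.
exists (linear_form (u.1.2 * v.2 - u.2 * v.1.2) (u.2 * v.1.1 - u.1.1 * v.2)
                    (u.1.1 * v.1.2 - u.1.2 * v.1.1)).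
split; first exact: linear_form_homog.
- apply: linear_form_neq0; rewrite /u /v {u v}; apply/eqP.
  case: P PQ => [a b|a|]; case: Q => [a' b'|a'|] PQ //= [];
    rewrite ?(mulr0, mul0r, mulr1, mul1r, subr0, sub0r) => e1 e2 e3;
    try (by move/eqP: e1; rewrite ?oppr_eq0 oner_eq0);
    try (by move/eqP: e2; rewrite ?oppr_eq0 oner_eq0);
    try (by move/eqP: e3; rewrite ?oppr_eq0 oner_eq0).
    by apply: PQ; rewrite (subr0_eq e1) (subr0_eq e2).
  by apply: PQ; rewrite (subr0_eq e3).
- by rewrite goes_through_plane_point -/u; apply/eqP; ring.
by rewrite goes_through_plane_point -/v; apply/eqP; ring.
Qed.

Lemma line_through_tangent P d :
  exists l, [/\ l \is 1.-homog, l != 0,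
                goes_through l (P, [::]) & goes_through l (P, [:: d])].
Proof.
(* The germ with tangent direction [d] is y - c x = 0 or x = 0; the constant term of the form is
   then chosen to make the line pass through [P]. *)
pose ab : k * k := if d is Some c then (- c, 1) else (1, 0).
have ab0 : (ab.1 != 0) || (ab.2 != 0).
  by rewrite {}/ab; case: d => [c|] /=; rewrite oner_eq0 ?orbT.
have [a [b [c def_l]]] : exists a b c,
    local_form P (linear_form a b c) = linear_germ ab.1 ab.2.
  case: P => [a b|a|].
  - exists ab.1, ab.2, (- (ab.1 * a + ab.2 * b)).
    by rewrite local_form_linear subrr addr0.
  - exists ab.1, (- (ab.1 * a)), ab.2.
    by rewrite local_form_linear subrr addr0.
  by exists 0, ab.1, ab.2; rewrite local_form_linear addr0.
exists (linear_form a b c); split; first exact: linear_form_homog.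
- apply: contraTneq (linear_germ_neq0 ab0) => l0; rewrite -def_l l0 negbK.
  by case: P {def_l} => * /=; rewrite comp_mpoly0.
- rewrite /goes_through /strict_eq_at def_l /= -[linear_germ _ _]addr0.
  by rewrite vanishes0_germ.
rewrite /goes_through /strict_eq_at def_l /= linear_germ_strict_eq // /ab.
by clear -d; case: d => [e|]; rewrite vanishes0_affine //= mul1r addNr.
Qed.

End Fibers.

(** * Bounds for the vectors of the cone, and existence of the value a *)

Section Cone.
Variables (k : closedFieldType) (n : nat) (p : 'I_n.+2 -> near_point k).
Hypothesis hp : is_configuration p.

Lemma config_inj : injective p.
Proof.
have aux (i j : 'I_n.+2) : (i < j)%N -> p i <> p j.
  by move=> ij eq_p; have [[]] := hp j; exists i.
move=> i j eq_p; apply: val_inj; case: (ltngtP i j) => // [/aux|/aux] //.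
by rewrite eq_p.
Qed.

Lemma config_origin : (p ord0).2 = [::].
Proof.
case def_s: (p ord0).2 => [|d s] //; have [_ /(_ ((p ord0).1, [::]))] := hp ord0.
by case=> //; split=> //; exists d, s.
Qed.

(** With only p_1 blown up, a point is either another point of the plane, joined to p_1 by a line,
    or a direction at p_1, tangent to a line. *)
Lemma fiber_exists q : on_F1 p q ->
  exists l, fiber_eq p l /\ goes_through l q.
Proof.
case: q => Q s [nq below]; have := config_origin; move: nq below.
rewrite /fiber_eq; case: (p ord0) => P s0 nq below /= s00; rewrite {}s00 in nq below *.
have s_below s1 d s2 : s = s1 ++ d :: s2 -> (Q, s1) = (P, [::]).
  by move=> def_s; apply: below; split=> //; exists d, s2.
case: s nq s_below {below} => [|d [|d' s]] nq s_below.
- have /line_through_points[l [l1 l0 lP lQ]] : P <> Q by move=> PQ; apply: nq; rewrite PQ.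
  by exists l.
- have [[-> ]] := s_below [::] d [::] erefl.
  by have [l [l1 l0 lP lQ]] := line_through_tangent P d; exists l.
by have := s_below [:: d] d' s erefl.
Qed.

Variable R : realType.
Variables (x y : R) (m : 'I_n.+1 -> R).
Hypothesis hm : @in_cone R (apg_F1 p) x y m.

(** Downward induction on the index: points proximate to p_i have larger indices, and a sum over
    none of them is 0. *)
Lemma cone_ge0 i : 0 <= m i.
Proof.
have [prox _ _] := hm; have [N leN] := ubnP (n.+1 - i); elim: N i leN => // N IHN i leN.
apply: le_trans (prox i); apply: sumr_ge0 => j /asboolP[ij _]; apply: IHN.
have {}ij : (i < j)%N by [].
by rewrite -ltnS; apply: leq_trans leN; rewrite ltnS ltn_sub2l.
Qed.

Lemma cone_prox_le i j : proximate p (lift ord0 j) (lift ord0 i) -> m j <= m i.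
Proof.
move=> ij; have [prox _ _] := hm; apply: le_trans (prox i).
rewrite (bigD1 j) /=; last exact/asboolP.
by rewrite lerDl sumr_ge0 // => h _; apply: cone_ge0.
Qed.

(** A point on the Hirzebruch surface lies on a fiber. Any other point is proximate to the point it
    was created from, which has a smaller index and at least the same [m]. *)
Lemma cone_le_fiber i : m i <= y.
Proof.
have [N leN] := ubnP i; elim: N i leN => // N IHN i leN.
have [onF|] := pselect (on_F1 p (p (lift ord0 i))).
  have [l [fib lq]] := fiber_exists onF; have [_ hF _] := hm.
  apply: le_trans (hF [set j | goes_through l (p (lift ord0 j))]%SET _); last first.
    by exists l; split=> //; exists i.
  rewrite (bigD1 i) ?inE //= lerDl sumr_ge0 // => h _; exact: cone_ge0.
move=> noF; have [nq below] := hp (lift ord0 i).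
have [s' [d def_s]] : exists s' d, (p (lift ord0 i)).2 = rcons s' d.
  case/lastP def_s: (p (lift ord0 i)).2 => [|s' d]; last by exists s', d.
  case: noF; split=> [eq0|r [_ [d [e]]]]; last by rewrite def_s; case: r.2.
  by apply: nq; exists ord0.
have [j ltj def_j] : exists2 j : 'I_n.+2, (j < lift ord0 i)%N &
    ((p (lift ord0 i)).1, s') = p j.
  by apply: below; split=> //; exists d, [::]; rewrite def_s cats1.
have [j' def_j'] : exists j', j = lift ord0 j'.
  case: (unliftP ord0 j) => [j' ->|j0]; first by exists j'.
  (* If the preceding point were p_1, the point would be a single direction at p_1 and so would lie
     on the Hirzebruch surface. *)
  case: noF; split=> [eq0|r [r1 [d' [e def_r]]]]; first by apply: nq; exists ord0.
  have := config_origin; rewrite -j0 -def_j /= => s'0.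
  rewrite def_s s'0 in def_r; rewrite s'0.
  by case: r r1 def_r => r1 [|? [|? ?]] //= ->.
subst j; apply: le_trans (IHN j' _); last first.
  have {}ltj : (j' < i)%N by [].
  by rewrite ltnS in leN; apply: leq_trans leN.
apply: cone_prox_le; split=> //; rewrite -def_j; split=> //.
exists d, [::]; rewrite cats1; split=> //.
by case: d {def_s}; rewrite /= /vanishes0 mcoeffX mnm1_eq0.
Qed.

Lemma cone_form_ge0 : 0 <= 2 * x * y + n.+1%:R * y ^+ 2 - \sum_i m i ^+ 2.
Proof.
have y0 : 0 <= y := le_trans (cone_ge0 ord0) (cone_le_fiber ord0).
have x0 : 0 <= x.
  have [_ _ sec] := hm; apply: le_trans sec; apply: sumr_ge0 => i _; exact: cone_ge0.
rewrite -addrA addr_ge0 ?mulr_ge0 // subr_ge0.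
rewrite mulr_natl -[X in _ <= _ *+ X]card_ord -sumr_const.
by apply: ler_sum => i _; rewrite lerXn2r ?nnegrE ?cone_ge0 ?cone_le_fiber.
Qed.

End Cone.

Lemma a_value_admissible (R : realType) (k : closedFieldType) (n : nat)
    (p : 'I_n.+2 -> near_point k) :
  is_configuration p -> a_admissible R (apg_F1 p) (a_value R (apg_F1 p)).
Proof.
move=> hp; suff [] : a_admissible R (apg_F1 p) (a_value R (apg_F1 p)) /\
  (forall s, a_admissible R (apg_F1 p) s -> (a_value R (apg_F1 p) <= s)%N) by [].
rewrite /a_value; apply: (xgetPex 0%N (P := fun t => a_admissible R (apg_F1 p) t /\
  (forall s, a_admissible R (apg_F1 p) s -> (t <= s)%N))).
have ex_t : exists t, `[< a_admissible R (apg_F1 p) t >].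
  (* The number of points blown up on the Hirzebruch surface is admissible, so a least value exists
     and the default 0 of [xget] is not taken. *)
  by exists n.+1; apply/asboolP; split=> // x y m; apply: cone_form_ge0.
exists (ex_minn ex_t); case: ex_minnP => t /asboolP adm_t min_t; split=> // s adm_s.
by apply: min_t; apply/asboolP.
Qed.

(** * Proximity inequalities for a plane curve *)

Section CurveMultiplicities.
Variables (k : closedFieldType) (N : nat) (p : 'I_N.+1 -> near_point k).
Hypothesis injp : injective p.

Lemma mult_proximity (F : {mpoly k[3]}) i :
  (\sum_(j | `[< proximate p j i >]) mult_at F (p j) <= mult_at F (p i))%N.
Proof.
pose l := size (p i).2.
(* For a point proximate to [p i], the directions after those of [p i] are cut into the first one
   and the rest; the default [None] is not reached for such points. *)
pose d j := nth None (p j).2 l; pose s j := drop l.+1 (p j).2.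
pose A := [set j | `[< proximate p j i >]]%SET.
have onA j : j \in A -> [/\ (p j).1 = (p i).1, (p j).2 = (p i).2 ++ d j :: s j &
    vanishes0 (foldl (@strict_eq k) (exceptional_eq (d j)) (s j))].
  rewrite inE => /asboolP[_ [eq1 [d' [e [def_j van]]]]].
  have dj : d j = d' by rewrite /d def_j nth_cat ltnn subnn.
  have sj : s j = e.
    by rewrite /s def_j -cat_rcons drop_size_cat // size_rcons.
  by rewrite dj sj; split.
rewrite (eq_bigl (mem A)); last by move=> j; rewrite !inE.
rewrite (eq_bigr (fun j => mult0 (foldl (@strict_eq k) (strict_eq_at F (p i)) (d j :: s j)))).
  apply: proximity_inequality => [j /onA[] //|j j' /onA[e1 e2 _] /onA[e1' e2' _] eq_d eq_s].
  by apply: injp; apply: injective_projections; rewrite ?e1 ?e1' // e2 e2' eq_d eq_s.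
by move=> j /onA[e1 e2 _]; rewrite /mult_at /strict_eq_at e1 e2 foldl_cat.
Qed.

End CurveMultiplicities.

(** * Intersection numbers in the basis of total transforms *)

Section IntersectionNumbers.
Variables (N : nat) (k : closedFieldType) (p : 'I_N.+1 -> near_point k).
Variable C : integral_curve k.

Let M i := mult_at (curve_eq C) (p i).

Lemma strict_class_coords :
  (strict_class p C 0 ord0 = (curve_deg C)%:Z) *
  (forall i, strict_class p C 0 (lift ord0 i) = - (M i)%:Z).
Proof.
split=> [|i]; rewrite /strict_class !mxE summxE.
  rewrite eqxx mulr1 big1 ?subr0 // => j _.
  by rewrite !mxE /= mulr0.
rewrite /= mulr0 sub0r (bigD1 i) //= !mxE !eqxx mulr1 big1 ?addr0 // => j ji.
by rewrite !mxE (inj_eq lift_inj) [i == j]eq_sym (negPf ji) mulr0.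
Qed.

Lemma self_intersection : intersection (strict_class p C) (strict_class p C)
  = (curve_deg C)%:Z ^+ 2 - \sum_i (M i)%:Z ^+ 2.
Proof.
rewrite /intersection !strict_class_coords -expr2; congr (_ - _).
by apply: eq_bigr => i _; rewrite !strict_class_coords mulrNN expr2.
Qed.

Lemma intersection_Lstar_Estar (a b : int) :
  intersection (a *: Lstar N.+1 - b *: Estar ord0) (strict_class p C)
  = a * (curve_deg C)%:Z - b * (M ord0)%:Z.
Proof.
rewrite /intersection strict_class_coords !mxE eqxx mulr1 mulr0 subr0; congr (_ - _).
rewrite (bigD1 ord0) //= big1 => [|i i0].
  by rewrite strict_class_coords !mxE !eqxx /= mulr0 mulr1 sub0r mulrNN addr0.
by rewrite !mxE (inj_eq lift_inj) (negPf i0) /= !mulr0 subr0 mul0r.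
Qed.

End IntersectionNumbers.

Lemma curve_in_cone (R : realType) (k : closedFieldType) (n : nat)
    (p : 'I_n.+2 -> near_point k) (C : integral_curve k) :
  is_configuration p -> ~ line_through C (p ord0) ->
  let M i := mult_at (curve_eq C) (p i) in
  @in_cone R (apg_F1 p) (M ord0)%:R ((curve_deg C)%:R - (M ord0)%:R)
    (fun i => (M (lift ord0 i))%:R).
Proof.
move=> hp nC M; have injp := config_inj hp; split=> [i|F [l [[hl l0 l_p0] _ ->]]|].
- rewrite -natr_sum ler_nat; apply: leq_trans (mult_proximity injp _ (lift ord0 i)).
  by rewrite big_mkcond [X in (_ <= X)%N]big_mkcond [X in (_ <= X)%N]big_ord_recl; apply: leq_addl.
(* The multiplicity at p_1 joins the sum: the line passes through p_1, so the bound is Bezout over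
   all its points, p_1 included. *)
- rewrite lerBrDl -natr_sum -natrD ler_nat.
  pose A := [set j | goes_through l (p j)]%SET.
  have lA : {in A, forall j, goes_through l (p j)} by move=> j; rewrite inE.
  apply: leq_trans (sum_mult_line_le (curve_homog C) hl l0
    (curve_line_or_ndvd hl l0 l_p0 nC) (in2W injp) lA).
  rewrite [X in (_ <= X)%N]big_mkcond [X in (_ <= X)%N]big_ord_recl inE l_p0 leq_add2l big_mkcond.
  by apply: leq_sum => i _; rewrite !inE.
rewrite -natr_sum ler_nat; apply: leq_trans (mult_proximity injp _ ord0).
rewrite big_mkcond [X in (_ <= X)%N]big_mkcond [X in (_ <= X)%N]big_ord_recl.
by apply: leq_trans (leq_addl _ _); apply: leq_sum => i _; rewrite inE.
Qed.

Theorem theorem3p8 (R : realType) (k : closedFieldType) (n : nat)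
    (p : 'I_n.+2 -> near_point k) (hp : is_configuration p)
    (iota tau : nat)
    (hD : iota%:Z *: Lstar n.+2 - tau%:Z *: Estar ord0 != 0)
    (hit : (tau <= iota)%N)
    (C : integral_curve k) (hC : ~ line_through C (p ord0)) :
  let a := a_value R (apg_F1 p) in
  let D := iota%:Z *: Lstar n.+2 - tau%:Z *: Estar ord0 in
  let Ct := strict_class p C in
  (intersection Ct Ct)%:~R / (intersection D Ct)%:~R ^+ 2
    >= - (a%:R - 1) :> R.
Proof.
cbv zeta; set a := a_value R (apg_F1 p); have cone := curve_in_cone R hp hC.
have [a_gt0 /(_ _ _ _ cone)] := a_value_admissible R hp; rewrite -/a.
(* The vertex [ord0] is p_2, present since there are at least two points; it shows that y is
   nonnegative. *)
have := le_trans (cone_ge0 cone ord0) (cone_le_fiber hp cone ord0).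
set d := (curve_deg C)%:R; set m := (mult_at _ (p ord0))%:R.
set S := \sum_i _ => y_ge0 form_ge0.
have -> : (intersection (strict_class p C) (strict_class p C))%:~R
    = d ^+ 2 - m ^+ 2 - S :> R.
  rewrite self_intersection big_ord_recl opprD addrA !rmorphB !rmorphXn /= rmorph_sum.
  by congr (_ - _); apply: eq_bigr => i _; rewrite rmorphXn.
rewrite intersection_Lstar_Estar rmorphB !rmorphM /= -!pmulrn -/d -/m.
have m_ge0 : 0 <= m by exact: ler0n.
have iota_ge1 : 1 <= iota%:R :> R.
  rewrite ler1n lt0n; apply: contraNneq hD => iota0.
  by move: hit; rewrite iota0 leqn0 => /eqP ->; rewrite !scale0r subrr.
have tau_le : tau%:R <= iota%:R :> R by rewrite ler_nat.
have a_ge1 : 1 <= a%:R :> R by rewrite ler1n.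
set r := iota%:R * d - tau%:R * m.
have le_yr : d - m <= r.
  have -> : r = iota%:R * (d - m) + (iota%:R - tau%:R) * m by rewrite /r; ring.
  by rewrite -[leLHS]addr0 lerD ?mulr_ge0 ?subr_ge0 // ler_peMl.
(* When the denominator is 0 the quotient is 0 by convention, and the bound holds because a is at
   least 1. *)
have [->|r0] := eqVneq r 0; first by rewrite expr0n invr0 mulr0 oppr_le0 subr_ge0.
have r2_gt0 : 0 < r ^+ 2 by rewrite exprn_even_gt0.
rewrite ler_pdivlMr //.
(* With y = d - m one has d^2 - m^2 = 2 m y + y^2, so [form_ge0] bounds the self-intersection below
   by -(a - 1) y^2, and y is at most [r]. *)
have : (a%:R - 1) * (d - m) ^+ 2 <= (a%:R - 1) * r ^+ 2.
  by rewrite ler_wpM2l ?subr_ge0 // lerXn2r ?nnegrE // (le_trans y_ge0).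
by nra.
Qed.
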